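(* Let $G$ be a group, and let $\mathcal{O}_{Rel}(G)$ be the set of all relative orders of $G$, with the topology induced by the embedding $\preceq\,\mapsto\phi_{(\preceq,C)}$ into $\{1,-1,*\}^G$ with the product topology. Then: (1) if $G$ is finitely generated, $\mathcal{O}_{Rel}(G)$ is compact; (2) $G$ acts on $\mathcal{O}_{Rel}(G)$ by homeomorphisms through conjugation, i.e. through the maps $\phi\mapsto\phi^g$ ($g\in G$), where $\phi^g(h)=\phi(ghg^{-1})$ for $h\in G$; (3) if $C$ is a relatively convex subgroup of $G$, then $C$ fixes a point of $\mathcal{O}_{Rel}(G)$, i.e. there is $\phi\in\mathcal{O}_{Rel}(G)$ with $\phi^c=\phi$ for all $c\in C$.
   Context: A proper subgroup $C$ of a group $G$ is relatively convex if there is a total order $\preceq$ on the set of left cosets $G/C$ which is invariant under left multiplication by $G$: if $fC\preceq gC$ then $hfC\preceq hgC$ for all $f,g,h\in G$. Such an order $\preceq$ is called a relative order of $G$ with respect to $C$. $\mathcal{O}_{Rel}(G)$ denotes the set of all relative orders of $G$, with respect to all relatively convex (in particular proper) subgroups $C$. A relative order $\preceq$ with respect to $C$ is identified with the function $\phi_{(\preceq,C)}\in\{1,-1,*\}^G$ given by $\phi_{(\preceq,C)}(g)=1$ if $C\prec gC$, $\phi_{(\preceq,C)}(g)=-1$ if $gC\prec C$, and $\phi_{(\preceq,C)}(g)=*$ if $gC=C$. The set $\{1,-1,*\}$ is given the discrete topology. The formula $\phi^g(h)=\phi(ghg^{-1})$ gives $(\phi^g)^k=\phi^{gk}$, so with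 this convention the action is written as a right action. *)

(* Defs.v *)
From HB Require Import structures.
From mathcomp Require Import all_boot.
From mathcomp Require Import all_classical topology.

Set Implicit Arguments.
Unset Strict Implicit.
Unset Printing Implicit Defensive.

Local Open Scope classical_set_scope.
Local Open Scope group_scope.

(* [Star] encodes the symbol * in {1, -1, *}. *)
Inductive sign3 := Pos | Neg | Star.

Definition sign3_code (s : sign3) : option bool :=
  match s with Pos => Some true | Neg => Some false | Star => None end.

Definition sign3_decode (o : option bool) : sign3 :=
  match o with Some true => Pos | Some false => Neg | None => Star end.

Lemma sign3_codeK : cancel sign3_code sign3_decode.
Proof. by case. Qed.

HB.instance Definition _ := Finite.copy sign3 (can_type sign3_codeK).

Section Groups.
Variable G : groupType.
Implicit Types (C H S : set G) (f g h k : G).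

Definition subgroup H : Prop := group_closed [in H].

Definition finitely_generated : Prop :=
  exists2 S, finite_set S & smallest subgroup S = setT.

Definition lcoset C g : set G := [set g * c | c in C].

Definition cosets C : set (set G) := range (lcoset C).

(* The coset g C as a point of G / C; in particular [coset C 1] is C itself. *)
Definition coset C g : cosets C := SigSub (mem_set (imageT (lcoset C) g)).

Definition total_order (T : Type) (le : rel T) : Prop :=
  [/\ reflexive le, antisymmetric le, transitive le & total le].

Definition left_invariant C (le : rel (cosets C)) : Prop :=
  forall f g h, le (coset C f) (coset C g) ->
                le (coset C (h * f)) (coset C (h * g)).

Definition relatively_convex C : Prop :=
  [/\ subgroup C, C `<` setT &
      exists le : rel (cosets C), total_order le /\ left_invariant le].

Record relative_order := RelativeOrder {
  ro_sub : set G;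
  ro_le : rel (cosets ro_sub);
  ro_subgroup : subgroup ro_sub;
  ro_proper : ro_sub `<` setT;
  ro_total : total_order ro_le;
  ro_invariant : left_invariant ro_le }.

Definition ro_lt (r : relative_order) (x y : cosets (ro_sub r)) : bool :=
  (x != y) && ro_le x y.

(* {1, -1, *}^G, with the product of the discrete topologies. *)
Definition sign_space : Type := {ptws G -> discrete_topology sign3}.

HB.instance Definition _ :=
  Topological.copy sign_space {ptws G -> discrete_topology sign3}.

Definition phi (r : relative_order) : sign_space := fun g =>
  let C := coset (ro_sub r) 1 in
  let gC := coset (ro_sub r) g in
  if ro_lt C gC then Pos else if ro_lt gC C then Neg else Star.

(* A relative order is identified with its image under [phi], see [phi_inj];
   as a type, this set carries the topology induced by sign_space. *)
Definition ORel : set sign_space := range phi.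

Definition conj_sign (p : sign_space) g : sign_space :=
  fun h => p (g * h * g^-1).

Lemma coset_eqP C g : subgroup C -> coset C 1 = coset C g <-> C g.
Proof.
move=> sC; have [C1 _] := sC; split=> [/(congr1 val) /= e | Cg].
  suff: lcoset C 1 g by case=> c Cc <-; rewrite mul1g.
  by rewrite e; exists 1; [exact: set_mem | rewrite mulg1].
apply/val_inj/seteqP; split=> x [c Cc <-].
  exists (g^-1 * c); last by rewrite mulVKg mul1g.
  apply/set_mem; rewrite (group_closedM sC) //; last exact: mem_set.
  by rewrite (group_closedV sC) //; exact: mem_set.
exists (g * c); last by rewrite mul1g.
by apply/set_mem; rewrite (group_closedM sC) //; exact: mem_set.
Qed.

Lemma phiP (r : relative_order) g :
  [/\ phi r g = Pos <-> ro_lt (coset (ro_sub r) 1) (coset (ro_sub r) g),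
      phi r g = Neg <-> ro_lt (coset (ro_sub r) g) (coset (ro_sub r) 1)
    & phi r g = Star <-> coset (ro_sub r) g = coset (ro_sub r) 1].
Proof.
have [_ anti _ tot] := ro_total r; rewrite /phi /ro_lt /= [_ g == _]eq_sym.
have [<-|ne] /= := eqVneq; first by split.
have nge : coset (ro_sub r) g <> coset (ro_sub r) 1.
  by move=> e; rewrite e eqxx in ne.
have := tot (coset (ro_sub r) 1) (coset (ro_sub r) g).
have := anti (coset (ro_sub r) 1) (coset (ro_sub r) g).
case: (ro_le _ _) => /=; case: (ro_le _ _) => //= a _.
by case: nge; rewrite a.
Qed.

Lemma phi_inj : injective phi.
Proof.
move=> r s e.
have eC : ro_sub r = ro_sub s.
  apply/seteqP; split=> g.
    move=> /(coset_eqP g (ro_subgroup r)) /esym.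
    have [_ _ <-] := phiP r g; rewrite e; have [_ _ ->] := phiP s g.
    by move=> /esym /(coset_eqP g (ro_subgroup s)).
  move=> /(coset_eqP g (ro_subgroup s)) /esym.
  have [_ _ <-] := phiP s g; rewrite -e; have [_ _ ->] := phiP r g.
  by move=> /esym /(coset_eqP g (ro_subgroup r)).
have le_phi (t : relative_order) f g :
    ro_le (coset (ro_sub t) f) (coset (ro_sub t) g) <->
    phi t (f^-1 * g) <> Neg.
  have [rf anti _ tot] := ro_total t; have inv := @ro_invariant t.
  have [_ -> _] := phiP t (f^-1 * g); rewrite /ro_lt.
  have -> : ro_le (coset (ro_sub t) f) (coset (ro_sub t) g) =
            ro_le (coset (ro_sub t) 1) (coset (ro_sub t) (f^-1 * g)).
    apply/idP/idP => [/(inv _ _ f^-1)|/(inv _ _ f)].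
      by rewrite mulVg.
    by rewrite mulg1 mulVKg.
  set x := coset _ 1; set y := coset _ _; split.
    by move=> xy /andP[/eqP ne yx]; apply: ne; apply: anti; rewrite yx.
  move=> /negP; rewrite negb_and negbK => /orP[/eqP ->|]; first exact: rf.
  by have := tot x y; case: (ro_le y x); rewrite ?orbF.
case: r s e eC le_phi => C le sC pC tC iC [D le' sD pD tD iD] e /= eC le_phi.
move: le' sD pD tD iD e; case: D / eC => le' sD pD tD iD e.
have ele : le = le'.
  apply/funext => -[x /[dup] /set_mem [f _ <-] xC].
  apply/funext => -[y /[dup] /set_mem [g _ <-] yC].
  have -> : exist _ (lcoset C f) xC = coset C f by exact: val_inj.
  have -> : exist _ (lcoset C g) yC = coset C g by exact: val_inj.
  apply/idP/idP.
    move/(le_phi (RelativeOrder sC pC tC iC) f g); rewrite e.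
    by move/(le_phi (RelativeOrder sD pD tD iD) f g).
  move/(le_phi (RelativeOrder sD pD tD iD) f g); rewrite -e.
  by move/(le_phi (RelativeOrder sC pC tC iC) f g).
move: tD iD e; rewrite -ele => tD iD _.
by congr RelativeOrder; exact: Prop_irrelevance.
Qed.

End Groups.

Arguments ORel : clear implicits.

Definition homeomorphism (X Y : topologicalType) (f : X -> Y) : Prop :=
  continuous f /\
  exists f' : Y -> X, [/\ continuous f', cancel f f' & cancel f' f].

(* Main.v *)
(* A sign function p is the code of a relative order iff p(g^-1) = -p(g) for all
   g, the set {p <> Neg} is closed under products, and p is not constantly Star:
   the subgroup is then C = {p = Star}, and f C <= g C means p(f^-1 g) <> Neg.
   Each instance of the first two conditions involves finitely many values of p,
   so they are closed conditions; when G is generated by a finite set S, so is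
   the third, since a proper subgroup misses some element of S.  Hence ORel is
   closed in a compact product.  All three conditions are invariant under
   conjugation.  Finally C fixes any order relative to C: if c is in C then c
   and c^-1 both lie in {p <> Neg}, so g does iff c g c^-1 does. *)
Require Import Defs.
From mathcomp Require Import all_boot finmap.
From mathcomp Require Import all_classical topology.

Local Open Scope classical_set_scope.
Local Open Scope group_scope.

(** Push the filter forward along [val]: a cluster point in [A] clusters the original filter too,
    because open sets of the subtype are traces of open sets of [X]. *)
Lemma compact_set_type (X : topologicalType) (A : set X) :
  compact A -> compact [set: A].
Proof.
move=> cA F FF _.
have [|x [Ax clx]] := cA _ (fmap_proper_filter (fun a : A => val a) FF).
  by apply: (@filterS _ F) filterT => a _; exact: set_mem (valP a).
exists (SigSub (mem_set Ax)); split=> // P Q FP [_ [[U oU <-] Ux UQ]].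
have [||y [[a Pa <-] Ua]] := clx [set val a | a in P] U.
- by apply: (@filterS _ F) FP => a Pa; exists a.
- exact: open_nbhs_nbhs.
by exists a; split=> //; apply: UQ.
Qed.

(** * Conditions satisfied by the sign function of a relative order *)

Section RelativeOrders.
Set Implicit Arguments.
Unset Strict Implicit.
Variable G : groupType.
Implicit Types (p q : sign_space G) (f g h : G) (r : relative_order G).

Definition odd_sign p := forall g, p g = Neg <-> p g^-1 = Pos.

Definition nonneg_mul p :=
  forall g h, p g <> Neg -> p h <> Neg -> p (g * h) <> Neg.

Lemma ro_leM r f g h :
  ro_le (coset (ro_sub r) (h * f)) (coset (ro_sub r) (h * g)) =
  ro_le (coset (ro_sub r) f) (coset (ro_sub r) g).
Proof.
apply/idP/idP => [/(ro_invariant h^-1)|]; last exact: ro_invariant.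
by rewrite !mulKg.
Qed.

Lemma ro_ltNge r (x y : cosets (ro_sub r)) : ro_lt x y = ~~ ro_le y x.
Proof.
have [rf anti _ tot] := ro_total r; rewrite /ro_lt.
have [->|/eqP ne /=] := eqVneq x y; first by rewrite rf.
have := tot x y; have := @anti x y.
by case: (ro_le x y); case: (ro_le y x) => //= /(_ isT) /ne.
Qed.

Lemma phi_nonneg r g :
  phi r g <> Neg <-> ro_le (coset (ro_sub r) 1) (coset (ro_sub r) g).
Proof.
have [_ -> _] := phiP r g; rewrite ro_ltNge.
by split=> [/negP/negPn|le1g]; last by rewrite le1g.
Qed.

Lemma phi_star r g : phi r g = Star <-> ro_sub r g.
Proof.
have [_ _ ->] := phiP r g.
by rewrite -(coset_eqP g (ro_subgroup r)); split=> /esym.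
Qed.

Lemma phi_odd r : odd_sign (phi r).
Proof.
move=> g; have [_ -> _] := phiP r g; have [-> _ _] := phiP r g^-1.
by rewrite !ro_ltNge -(ro_leM r _ 1 g) mulgV mulg1.
Qed.

Lemma phi_nonneg_mul r : nonneg_mul (phi r).
Proof.
have [_ _ trans _] := ro_total r.
move=> g h /phi_nonneg le1g /phi_nonneg le1h; apply/phi_nonneg.
by apply: trans le1g _; rewrite -{1}[g]mulg1 ro_leM.
Qed.

Lemma star_inv p g : odd_sign p -> p g = Star -> p g^-1 = Star.
Proof.
by move=> op pg; have := op g; have := op g^-1; rewrite invgK pg;
  case: (p g^-1) => // -[a b] [c d]; [have := d erefl | have := a erefl].
Qed.

(** With P = {p <> Neg}, the set {p = Star} is the intersection of P and its inverse, so questions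
    about [Star] reduce to products in P. *)
Lemma starP p g : odd_sign p -> p g = Star <-> p g <> Neg /\ p g^-1 <> Neg.
Proof.
move=> op; split=> [pg|[]]; first by rewrite star_inv ?pg.
by rewrite (op g^-1) invgK; case: (p g).
Qed.

Lemma coset_mulV (C : set G) f g :
  subgroup C -> C (f^-1 * g) -> coset C f = coset C g.
Proof.
have lcosetM (h k : G) : lcoset C (h * k) = [set h * x | x in lcoset C k].
  by rewrite image_comp; apply: eq_imagel => c _ /=; rewrite mulgA.
move=> sC /(coset_eqP _ sC) /(congr1 val) /= eC; apply: val_inj => /=.
by rewrite -[f in LHS]mulg1 lcosetM eC -lcosetM mulVKg.
Qed.

(** The values [Neg] at inverses determine the values [Pos], and [Star] is what remains. *)
Lemma odd_sign_eq p q : odd_sign p -> odd_sign q ->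
  (forall g, p g <> Neg <-> q g <> Neg) -> p = q.
Proof.
move=> op oq pq.
have neg g : p g = Neg <-> q g = Neg.
  by split=> e; apply: contrapT => /pq.
apply/funext => g; have pos : p g = Pos <-> q g = Pos.
  by have := neg g^-1; rewrite op oq invgK.
case E : (p g); first exact/esym/pos; first exact/esym/neg.
by case F : (q g) => //; rewrite -E; [apply/pos | apply/neg].
Qed.

(** * Recovering a relative order from its sign function *)

Section Reconstruction.
Variable p : sign_space G.
Hypotheses (p_odd : odd_sign p) (p_mul : nonneg_mul p).
Hypothesis p_nontrivial : exists g, p g <> Star.

Let C : set G := [set g | p g = Star].

Lemma star_subgroup : subgroup C.
Proof.
(* Since 1 is its own inverse, either of [Pos] and [Neg] would force the other. *)
have p1 : p 1 = Star.
  have := p_odd 1; rewrite invg1; case: (p 1) => // -[pos neg].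
    by have := neg erefl.
  by have := pos erefl.
split=> [|g h]; rewrite !inE //.
move=> /(starP _ p_odd) [g0 gV0] /(starP _ p_odd) [h0 hV0].
by apply/(starP _ p_odd); rewrite invgM invgK; split; exact: p_mul.
Qed.

(** Quantifying over representatives avoids choosing them; [sign_leP] shows that any choice gives
    the same answer. *)
Definition sign_le : rel (cosets C) := fun x y =>
  `[< exists2 f, val x f & exists2 g, val y g & p (f^-1 * g) <> Neg >].

Lemma sign_leP f g :
  reflect (p (f^-1 * g) <> Neg) (sign_le (coset C f) (coset C g)).
Proof.
have [] := star_subgroup; rewrite inE => C1 _.
apply: (iffP (asboolP _)) => [[_ [c /(starP _ p_odd) [c0 _] <-]]|fg].
  move=> [_ [d /(starP _ p_odd) [_ d0] <-]].
  (* The representatives are f c and g d; multiplying c^-1 f^-1 g d by c on the left and d^-1 on the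
     right recovers f^-1 g. *)
  move=> /(p_mul c0) /p_mul /(_ d0).
  by rewrite invgM !mulgA mulgV mul1g mulgK.
by exists f; [exists 1; rewrite ?mulg1|exists g; [exists 1; rewrite ?mulg1|]].
Qed.

Lemma phi_surj : exists r, phi r = p.
Proof.
have cosetE (x : cosets C) : exists g, x = coset C g.
  by have [g _ xg] := set_valP x; exists g; apply: val_inj.
have [] := star_subgroup; rewrite inE => C1 _.
have tle : total_order sign_le.
  split.
  - by move=> x; have [g ->] := cosetE x; apply/sign_leP; rewrite mulVg C1.
  - move=> x y; have [f ->] := cosetE x; have [g ->] := cosetE y.
    move=> /andP[/sign_leP fg /sign_leP gf].
    apply: coset_mulV star_subgroup _; apply/(starP _ p_odd); split=> //.
    by rewrite invgM invgK.
  - move=> y x z; have [f ->] := cosetE x; have [g ->] := cosetE y.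
    have [h ->] := cosetE z => /sign_leP gf /sign_leP fh.
    by apply/sign_leP; have := p_mul gf fh; rewrite mulgA mulgK.
  - move=> x y; have [f ->] := cosetE x; have [g ->] := cosetE y.
    apply/orP; case E : (p (f^-1 * g)); [left|right|left]; apply/sign_leP;
      rewrite ?E //.
    (* If f^-1 g is negative, its inverse g^-1 f is positive. *)
    by have /p_odd := E; rewrite invgM invgK => ->.
have ile : left_invariant sign_le.
  by move=> f g h /sign_leP fg; apply/sign_leP; rewrite invgM -mulgA mulKg.
have Cp : C `<` setT.
  by split=> // TC; have [g] := p_nontrivial; apply; exact: TC.
exists (RelativeOrder star_subgroup Cp tle ile).
apply: odd_sign_eq p_odd _ => [|g]; first exact: phi_odd.
rewrite phi_nonneg /=; split=> [/sign_leP|pg]; first by rewrite invg1 mul1g.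
by apply/sign_leP; rewrite invg1 mul1g.
Qed.

End Reconstruction.

Lemma phi_nontrivial r : exists g, phi r g <> Star.
Proof.
have [_ sTC] := ro_proper r; apply: contrapT => /forallNP pS; apply: sTC => g _.
by apply/phi_star; exact: contrapT (pS g).
Qed.

Lemma ORelP p : ORel G p <->
  [/\ odd_sign p, nonneg_mul p & exists g, p g <> Star].
Proof.
split=> [[r _ <-]|[op mp np]].
  by split; [exact: phi_odd | exact: phi_nonneg_mul | exact: phi_nontrivial].
by have [r <-] := phi_surj op mp np; exists r.
Qed.

(** * Closedness and compactness *)

Lemma phi_nontrivial_gen r (S : set G) : smallest (@subgroup G) S = setT ->
  exists2 g, S g & phi r g <> Star.
Proof.
move=> genS; have [g pg] := phi_nontrivial r.
apply: contrapT => /forall2NP nS; apply: pg; apply/phi_star.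
have : smallest (@subgroup G) S g by rewrite genS.
apply: smallest_sub; first exact: ro_subgroup.
by move=> h Sh; apply/phi_star; have [|/contrapT] := nS h.
Qed.

(** Singletons are open in the discrete factors, so this is a finite intersection of open cylinders
    around [p]. *)
Lemma near_agree p (S : set G) : finite_set S ->
  \forall q \near p, forall g, S g -> q g = p g.
Proof.
move=> finS.
suff : nbhs p (\bigcap_(g in [set` fset_set S]) [set q | q g = p g]).
  by rewrite fset_setK.
apply: filter_bigI => g _.
exact: (@proj_continuous _ (fun=> discrete_topology sign3) g p [set p g]
  (discrete_set1 _)).
Qed.

Lemma closed_ORel : finitely_generated G -> closed (ORel G).
Proof.
move=> [S finS genS] p clp; apply/ORelP.
have agree (T : set G) : finite_set T ->
    exists r, forall g, T g -> phi r g = p g.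
  by move=> /near_agree /clp [_ [[r _ <-] rp]]; exists r.
split=> [g|g h|].
- have [|r rp] := agree [set g; g^-1]; first exact: finite_set2.
  by rewrite -!rp /=; [exact: phi_odd|right|left].
- have [|r rp] := agree [set g; h; g * h]; first exact: finite_set3.
  by rewrite -!rp /=; [exact: phi_nonneg_mul|right|left; right|left; left].
(* The order [r] is chosen before [g], so its witness must be sought in [S], where [r] is known to
   agree with [p]. *)
- have [r rp] := agree S finS; have [g Sg rg] := phi_nontrivial_gen r genS.
  by exists g; rewrite -rp.
Qed.

Lemma compact_sign_space : compact [set: sign_space G].
Proof.
have := @tychonoff G (fun=> discrete_topology sign3) (fun=> setT).
rewrite (_ : [set f | _] = setT); last by apply/seteqP; split.
by apply=> _; apply: finite_compact; exact: finite_finset.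
Qed.

(** * The conjugation action *)

Lemma conj_sign_ORel p g : ORel G p -> ORel G (conj_sign p g).
Proof.
move=> /ORelP [op mp [h ph]]; apply/ORelP; split.
- by move=> k; rewrite /conj_sign op !invgM invgK mulgA.
- move=> k l pk pl; rewrite /conj_sign.
  have -> : g * (k * l) * g^-1 = g * k * g^-1 * (g * l * g^-1).
    by rewrite !mulgA mulgVK.
  exact: mp.
- by exists (g^-1 * h * g); rewrite /conj_sign !mulgA mulgV mul1g mulgK.
Qed.

(** Continuity into a product is checked on coordinates, and the coordinate at h is the projection
    at g h g^-1. *)
Lemma conj_sign_continuous g : continuous (fun p => conj_sign p g).
Proof.
move=> p; apply/cvg_sup => [|h]; first exact/fmap_filter/nbhs_filter.
move: p; apply: continuous_comp_initial.
exact: (@proj_continuous _ (fun=> discrete_topology sign3) (g * h * g^-1)).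
Qed.

Lemma conj_phi r c : ro_sub r c -> conj_sign (phi r) c = phi r.
Proof.
have op := @phi_odd r; have mp := @phi_nonneg_mul r.
move=> /phi_star /(starP _ op) [c0 cV0].
have /ORelP [oq _ _] : ORel G (conj_sign (phi r) c).
  by apply: conj_sign_ORel; exists r.
apply: odd_sign_eq oq op _ => g; rewrite /conj_sign; split=> [pg|pg].
  (* Here g is written as c^-1 (c g c^-1) c. *)
  by have := mp _ _ (mp _ _ cV0 pg) c0; rewrite !mulgA mulVg mul1g mulgVK.
exact: mp (mp _ _ c0 pg) cV0.
Qed.

Definition conj_act (p : ORel G) g : ORel G :=
  SigSub (mem_set (conj_sign_ORel g (set_mem (valP p)))).

Lemma conj_act_continuous g : continuous (conj_act^~ g).
Proof.
apply: continuous_comp_initial => p.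
apply: (@continuous_comp _ _ _ (fun q : ORel G => val q)
  (fun q => conj_sign q g)).
  exact: initial_continuous.
exact: conj_sign_continuous.
Qed.

End RelativeOrders.

Theorem theorem1p4 (G : groupType) :
  [/\ finitely_generated G -> compact [set: ORel G],
      exists act : ORel G -> G -> ORel G,
        [/\ forall (p : ORel G) (g : G), val (act p g) = conj_sign (val p) g,
            forall p : ORel G, act p 1 = p,
            forall (p : ORel G) (g k : G), act (act p g) k = act p (g * k)
          & forall g : G, homeomorphism (fun p : ORel G => act p g)]
    & forall C : set G, relatively_convex C ->
        exists p : ORel G, forall c : G, C c -> conj_sign (val p) c = val p].
Proof.
split.
- move=> fg; apply: compact_set_type.
  exact: (subclosed_compact (closed_ORel fg) (@compact_sign_space G)).
- exists (@conj_act G).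
  have act1 (p : ORel G) : conj_act p 1 = p.
    apply: val_inj; apply/funext => h.
    by rewrite /= /conj_sign invg1 mulg1 mul1g.
  have actM (p : ORel G) g k : conj_act (conj_act p g) k = conj_act p (g * k).
    by apply: val_inj; apply/funext => h; rewrite /= /conj_sign invgM !mulgA.
  split=> // g; split; first exact: conj_act_continuous.
  exists (fun p => conj_act p g^-1); split; first exact: conj_act_continuous.
    by move=> p; rewrite actM mulgV act1.
  by move=> p; rewrite actM mulVg act1.
- move=> C [sC pC [le [tle ile]]].
  exists (SigSub (mem_set (imageT (@phi G) (RelativeOrder sC pC tle ile)))).
  by move=> c Cc; exact: conj_phi.
Qed.
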